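(* Let $G$ be a graph with convex balls. Let $u,u',v,v'$ be vertices of $G$, $k=d(u,v)$, $k'=d(u',v')$, and let $\gamma_{(u,v)}=(C_0,\dots,C_k)$ and $\gamma_{(u',v')}=(C'_0,\dots,C'_{k'})$ be the normal clique-paths, with $C_i=\{v\}$ for $i>k$ and $C'_i=\{v'\}$ for $i>k'$. Then for every $i\ge0$ and all $x\in C_i$, $y\in C'_i$, $$d(x,y)\le 7\max\{d(u,u'),d(v,v')\}.$$ Consequently, the set of normal clique-paths and the set of normal paths of $G$ satisfy the $2$-sided fellow traveler property, and thus each defines a geodesic bicombing of $G$.
   Context: Graphs are simple, undirected, connected, with all cliques finite; $d$ is the graph distance; $G$ has convex balls if each ball $B_r(v)$ contains every vertex on a shortest path between two of its vertices. For a vertex set $S$, $B^*_1(S)=\bigcap_{s\in S}B_1(s)$. For vertices $u,v$ with $d(u,v)=k$, the normal clique-path $\gamma_{(u,v)}=(C_0,\dots,C_k)$ is defined by $C_k=\{v\}$ and $C_{i}=B^*_1(C_{i+1})\cap B_{i}(u)$ for $i=k-1,\dots,0$ (so $C_0=\{u\}$). A normal path from $u$ to $v$ is a path $(u=u_0,\dots,u_k=v)$ with $u_i\in C_i$ for all $i$. A path $\gamma$ of length $n$ is parametrized as $\gamma:\{0,\dots,n\}\to V$ and extended by $\gamma(i)=\gamma(n)$ for $i>n$, with $\gamma(\infty)$ its endpoint; for clique-paths, $d(\gamma_1(i),\gamma_2(i))$ means the maximum distance between a vertex of the $i$-th clique of $\gamma_1$ and one of $\gamma_2$. A system $\mathcal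 P$ of (clique-)paths has the $2$-sided fellow traveler property if there are constants $C>0,D\ge0$ with $d(\gamma_1(i),\gamma_2(i))\le C\max\{d(\gamma_1(0),\gamma_2(0)),d(\gamma_1(\infty),\gamma_2(\infty))\}+D$ for all $\gamma_1,\gamma_2\in\mathcal P$ and all $i$; a geodesic bicombing is a system of shortest (clique-)paths, containing one between any two vertices, with this property.
   Formalization: The inequality is stated for (u,v) ≠ (u',v'); if u=u' and v=v' it fails as written, since two distinct vertices of one clique C_i (e.g. in K_4 minus the edge uv) are at distance 1 > 0. *)

(* Defs.v *)
From mathcomp Require Import all_boot all_order all_algebra.
From mathcomp Require Import all_classical reals.

Set Implicit Arguments.
Unset Strict Implicit.
Unset Printing Implicit Defensive.

Import Order.TTheory GRing.Theory Num.Theory.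
Local Open Scope classical_set_scope.

(* A finite sequence (x_0, ..., x_n) of vertices (T = V) or of cliques
   (T = set V): the pair of x_0 and the sequence x_1, ..., x_n. *)
Definition gpath (T : Type) : Type := (T * seq T)%type.

Definition plen (T : Type) (g : gpath T) : nat := size g.2.

Definition pstart (T : Type) (g : gpath T) : T := g.1.

Definition pend (T : Type) (g : gpath T) : T := last g.1 g.2.

(* g(i), extended by g(i) = g(n) for i > n *)
Definition pat (T : Type) (g : gpath T) (i : nat) : T :=
  nth (pend g) (g.1 :: g.2) i.

Definition shortest (T : Type) (P : set (gpath T)) : set (gpath T) :=
  [set g | P g /\ forall h, P h -> pstart h = pstart g -> pend h = pend g ->
     (plen g <= plen h)%N].

Definition fellow_traveler (R : realType) (T : Type) (d : T -> T -> nat)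
    (P : set (gpath T)) : Prop :=
  exists C D : R, [/\ (0 < C)%R, (0 <= D)%R &
    forall g h, P g -> P h -> forall i : nat,
      ((d (pat g i) (pat h i))%:R <=
       C * (maxn (d (pstart g) (pstart h)) (d (pend g) (pend h)))%:R + D)%R].

(* [all] is the set of all (clique-)paths, and [pt] views a vertex as a
   possible endpoint of one. *)
Definition geodesic_bicombing_for (R : realType) (V T : Type) (pt : V -> T)
    (d : T -> T -> nat) (all P : set (gpath T)) : Prop :=
  [/\ P `<=` shortest all,
      forall u v, exists g, [/\ P g, pstart g = pt u & pend g = pt v] &
      fellow_traveler R d P].

Section Graph.
Variables (V : choiceType) (e : rel V).

Definition is_path : set (gpath V) := [set g | path e g.1 g.2].

Definition connected_graph : Prop :=
  forall x y, exists g, [/\ is_path g, pstart g = x & pend g = y].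

Definition joined (x y : V) (n : nat) : bool :=
  `[< exists g, [/\ is_path g, pstart g = x, pend g = y & plen g = n] >].

(* The value 0 for vertices in different components is junk. *)
Definition dist (x y : V) : nat :=
  if pselect (exists n, joined x y n) is left h then ex_minn h else 0.

Definition ball (v : V) (r : nat) : set V := [set x | (dist v x <= r)%N].

Definition convex (S : set V) : Prop :=
  forall g, shortest is_path g -> S (pstart g) -> S (pend g) ->
    forall i, S (pat g i).

Definition convex_balls : Prop := forall v r, convex (ball v r).

Definition clique (K : set V) : Prop :=
  forall x y, K x -> K y -> x <> y -> e x y.

Definition finite_cliques : Prop := forall K, clique K -> finite_set K.

(* B^*_1(S) *)
Definition ball1s (S : set V) : set V := \bigcap_(s in S) ball s 1.

(* [ncliqueR u v j] is C_{k-j}, with k = d(u, v). *)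
Fixpoint ncliqueR (u v : V) (j : nat) : set V :=
  if j is j'.+1 then ball1s (ncliqueR u v j') `&` ball u (dist u v - j)
  else [set v].

Definition nclique (u v : V) (i : nat) : set V := ncliqueR u v (dist u v - i).

Definition normal_clique_path (u v : V) : gpath (set V) :=
  (nclique u v 0, [seq nclique u v i | i <- iota 1 (dist u v)]).

Definition normal_clique_paths : set (gpath (set V)) :=
  [set g | exists u v, g = normal_clique_path u v].

Definition normal_path (u v : V) (g : gpath V) : Prop :=
  [/\ is_path g, pstart g = u, pend g = v, plen g = dist u v &
      forall i, (i <= dist u v)%N -> pat (normal_clique_path u v) i (pat g i)].

Definition normal_paths : set (gpath V) :=
  [set g | exists u v, normal_path u v g].

Definition is_clique_path : set (gpath (set V)) :=
  [set g | (forall i, pat g i !=set0 /\ clique (pat g i)) /\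
           (forall i, (i < plen g)%N ->
              pat g i `&` pat g i.+1 = set0 /\
              clique (pat g i `|` pat g i.+1))].

(* The maximum of d over A x B; meaningful for finite A and B. *)
Definition cdist (A B : set V) : nat :=
  \big[maxn/0%N]_(p \in A `*` B) dist p.1 p.2.

Definition path_bicombing (R : realType) (P : set (gpath V)) : Prop :=
  geodesic_bicombing_for R id dist is_path P.

Definition clique_path_bicombing (R : realType) (P : set (gpath (set V))) :
    Prop :=
  geodesic_bicombing_for R (@set1 V) cdist is_clique_path P.

End Graph.

(* Main.v *)
(* It suffices to move one endpoint along one edge: moving the target costs at
   most 3, moving the source at most 4.  Since B^*_1 reverses inclusions, if v'
   is one step closer to u than v, then the i-th cliques towards v and v' are
   nested; two adjacent targets on the same sphere around u are joined through
   a vertex two levels closer to u (triangle-pentagon condition).  When the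
   source moves from u to u', the two clique-paths are followed backwards from
   v: slice by slice, they meet, or their cliques are completely joined, or
   (only for u, u' equidistant from v) they contain vertices x, y at distance
   at most 2, with x closer to u than to u' and y closer to u' than to u, a
   situation that then persists up to the edge u u'. *)

Require Import Defs.
From mathcomp Require Import all_boot all_order all_algebra.
From mathcomp Require Import all_classical reals.
From mathcomp Require Import zify.

Set Implicit Arguments.
Unset Strict Implicit.
Unset Printing Implicit Defensive.

Import Order.TTheory GRing.Theory Num.Theory.
Local Open Scope classical_set_scope.

(** * Sequences prolonged by their last entry *)

Section Sequences.
Variable T : Type.
Implicit Types (g : gpath T) (f : nat -> T).

Lemma pat_plen g : pat g (plen g) = pend g.
Proof. by rewrite /pat /plen {2}/pend -last_nth. Qed.

Lemma pat_ge g i : (plen g <= i)%N -> pat g i = pend g.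
Proof.
rewrite leq_eqVlt => /predU1P[<-|gi]; first exact: pat_plen.
by rewrite /pat nth_default.
Qed.

Lemma pat_map f n i :
  pat (f 0, [seq f j | j <- iota 1 n]) i = f (minn i n).
Proof.
have E j : (j <= n)%N -> pat (f 0, [seq f j | j <- iota 1 n]) j = f j.
  move=> jn; rewrite /pat -[_ :: _]/(map f (iota 0 n.+1)).
  by rewrite (nth_map 0) ?size_iota // nth_iota.
case: (leqP i n) => [/E //|/ltnW ni].
by rewrite -(E _ (leqnn n)) !pat_ge // /plen size_map size_iota.
Qed.

End Sequences.

(** * The graph metric *)

Section Distance.
Variables (V : choiceType) (e : rel V).
Hypotheses (e_sym : symmetric e) (e_irr : irreflexive e).
Hypothesis e_conn : connected_graph e.
Local Notation d := (dist e).

Lemma dist_le_plen g : is_path e g -> (d (pstart g) (pend g) <= plen g)%N.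
Proof.
move=> gP; rewrite /dist; case: pselect => [h|//].
by case: ex_minnP => m _; apply; apply/asboolP; exists g.
Qed.

Lemma dist_path x y :
  exists g, [/\ is_path e g, pstart g = x, pend g = y & plen g = d x y].
Proof.
have [g [gP gx gy]] := e_conn x y.
rewrite /dist; case: pselect => [h|[]]; last first.
  by exists (plen g); apply/asboolP; exists g.
by case: ex_minnP => m /asboolP.
Qed.

Lemma distxx x : d x x = 0.
Proof. by apply/eqP; rewrite -leqn0; exact: (@dist_le_plen (x, [::])). Qed.

Lemma dist_eq0 x y : d x y = 0 -> x = y.
Proof.
move=> d0; have [[a [|b s]] [_ /= ax ay]] := dist_path x y.
  by rewrite -ax -ay.
by rewrite d0.
Qed.

Lemma dist_triangle y x z : (d x z <= d x y + d y z)%N.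
Proof.
have [[a p] [/= pP ax ay <-]] := dist_path x y.
have [[b q] [/= qP bx bz <-]] := dist_path y z.
rewrite /pstart /pend /= in ax ay bx bz; subst a b z.
have := @dist_le_plen (x, p ++ q).
rewrite /is_path /pstart /pend /plen /= cat_path last_cat size_cat ay.
by apply; apply/andP.
Qed.

Lemma dist_sym x y : d x y = d y x.
Proof.
suff H a b : (d a b <= d b a)%N by apply/eqP; rewrite eqn_leq !H.
have [[c p] [/= pP cx cy <-]] := dist_path b a.
rewrite /pstart /pend /= in cx cy; subst b a.
have := @dist_le_plen (last c p, rev (belast c p)).
rewrite /is_path /pstart /pend /plen /= rev_path size_rev size_belast.
have -> : last (last c p) (rev (belast c p)) = c.
  by case: (p) => //= z q; rewrite rev_cons last_rcons.
apply; rewrite (@eq_path _ _ e) // => z t /=; exact: e_sym.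
Qed.

Lemma dist_edge x y : e x y -> d x y = 1.
Proof.
move=> exy; apply/eqP; rewrite eqn_leq; apply/andP; split.
  by apply: (@dist_le_plen (x, [:: y])); rewrite /is_path /= exy.
rewrite lt0n; apply/eqP => /dist_eq0 xy; by rewrite xy e_irr in exy.
Qed.

Lemma edge_dist x y : d x y = 1 -> e x y.
Proof.
move=> d1; have [[a [|b [|c s]]] [/= ]] := dist_path x y; rewrite /plen d1 //=.
by rewrite /is_path /pstart /pend /= andbT => ab <- <-.
Qed.

Lemma dist_succ x y n : d x y = n.+1 -> exists z, d x z = 1 /\ d z y = n.
Proof.
move=> dn; have [[a [|b s]] [/= ]] := dist_path x y; rewrite /plen dn //=.
rewrite /is_path /pstart /pend /= => /andP[ab sP] ax sy [sn].
subst a y; exists b; split; first exact: dist_edge.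
have := @dist_le_plen (b, s) sP; have := dist_triangle b x (last b s).
by rewrite dn (dist_edge ab) /pend /pstart /plen /= => *; lia.
Qed.

(** * Local consequences of convex balls *)

Hypothesis e_cb : convex_balls e.

(** Geodesics from [x] to [z] and from [z] to [y] concatenate to a shortest path through [z], to
    which convexity of the ball applies. *)
Lemma ball_between v r x y z : (d x z + d z y <= d x y)%N ->
  (d v x <= r)%N -> (d v y <= r)%N -> (d v z <= r)%N.
Proof.
have [[a p] [/= pP ax az pn]] := dist_path x z.
have [[b q] [/= qP bx bz qn]] := dist_path z y.
rewrite /pstart /pend /plen /= in ax az bx bz pn qn; subst a b y.
move=> dxy vx vy.
suff -> : z = pat (x, p ++ q) (size p).
  apply: (@e_cb v r (x, p ++ q)); [|by []|by rewrite /pend /= last_cat az].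
  split; first by rewrite /is_path /= cat_path az; apply/andP.
  move=> h hP hx hy; have := dist_le_plen hP.
  rewrite hx hy /pstart /pend /plen /= last_cat az size_cat; lia.
rewrite /pat /= -cat_cons nth_cat /= ltnSn -az (last_nth (pend (x, p ++ q))).
by [].
Qed.

Lemma midpoint x y : d x y = 2 -> exists z, d x z = 1 /\ d z y = 1.
Proof. exact: dist_succ. Qed.

(** Otherwise [z] would lie between [x] and [y], hence in the ball of radius [r] about [v]. *)
Lemma parents_adjacent v r z x y : d v z = r.+1 ->
  (d v x <= r)%N -> (d v y <= r)%N -> (d z x <= 1)%N -> (d z y <= 1)%N ->
  (d x y <= 1)%N.
Proof.
move=> vz vx vy zx zy; rewrite leqNgt; apply/negP => xy.
have: (d x z + d z y <= d x y)%N by rewrite (dist_sym x z); lia.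
by move=> /ball_between /(_ vx vy); lia.
Qed.

(** If [a] and [c] are at distance 2, then [b] lies between them, and both are in the unit ball
    about [f]. *)
Lemma square_chord a b c f : (d a b <= 1)%N -> (d b c <= 1)%N ->
  (d c f <= 1)%N -> (d f a <= 1)%N -> (d a c <= 1)%N \/ (d b f <= 1)%N.
Proof.
move=> ab bc cf fa; case: (leqP (d a c) 1) => ac; [by left|right].
rewrite dist_sym; apply: (@ball_between f 1 a c b) => //; first lia.
by rewrite dist_sym.
Qed.

(* A weak form of the triangle-pentagon condition. *)
Lemma grandparent_adjacent k u x y : (2 <= k)%N -> d u x = k -> d u y = k ->
  (d x y <= 1)%N ->
  exists z, [/\ (d u z + 2 <= k)%N, (d z x <= 2)%N & (d z y <= 2)%N].
Proof.
have parent (a b : V) n : d a b = n.+1 -> exists c, d c b = 1 /\ d a c = n.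
  rewrite dist_sym => /dist_succ[c [bc ca]]; exists c.
  by rewrite dist_sym (dist_sym a).
(* Triangle or pentagon: the parents [w], [w'] of [b], [c] yield the vertex at once, or they are
   joined by a midpoint [z] that may stay on their sphere. *)
have step n (a b c : V) : d a b = n.+2 -> d a c = n.+2 -> (d b c <= 1)%N ->
    (exists z, [/\ (d a z + 2 <= n.+2)%N, (d z b <= 2)%N & (d z c <= 2)%N]) \/
    exists w z w', [/\ d w b = 1, d w z = 1, d z w' = 1 & d w' c = 1] /\
      [/\ d a w = n.+1, d a z = n.+1, d a w' = n.+1 & d b w' = 2].
  move=> ab ac bc.
  have [w [wb aw]] := parent _ _ _ ab; have [w' [wc aw']] := parent _ _ _ ac.
  have wc_done w0 : d w0 b = 1 -> d a w0 = n.+1 -> (d w0 c <= 1)%N ->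
      exists z, [/\ (d a z + 2 <= n.+2)%N, (d z b <= 2)%N & (d z c <= 2)%N].
    move=> h1 h2 h3; have [s [sw as_]] := parent _ _ _ h2.
    have := dist_triangle w0 s b; have := dist_triangle w0 s c => *.
    by exists s; split; lia.
  have wb_done : (d w' b <= 1)%N ->
      exists z, [/\ (d a z + 2 <= n.+2)%N, (d z b <= 2)%N & (d z c <= 2)%N].
    move=> h; apply: (wc_done w') => //; last by rewrite wc.
    by have := dist_triangle w' a b; lia.
  case: (leqP (d w c) 1) => wc2; first by left; exact: (wc_done w).
  case: (leqP (d w' b) 1) => wb2; first by left; exact: wb_done.
  have bw' : d b w' = 2.
    have := dist_triangle c b w'; rewrite (dist_sym c) (dist_sym w') in wb2 *.
    by lia.
  have ww3 : (d w w' < 3)%N.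
    rewrite ltnNge; apply/negP => h.
    have: (d w b + d b w' <= d w w')%N by lia.
    move=> /(@ball_between a n.+1).
    by rewrite aw aw' ab ltnn => /(_ (leqnn _) (leqnn _)).
  case: (leqP (d w w') 1) => ww.
    have [] := @square_chord w b c w'; rewrite ?wb ?(dist_sym c) ?wc //;
      rewrite ?(dist_sym w') //; lia.
  have [z [wz zw]] : exists z, d w z = 1 /\ d z w' = 1.
    by apply: midpoint; lia.
  have az : (d a z <= n.+1)%N.
    by apply: (@ball_between _ _ w w') => //; lia.
  case: (leqP (d a z) n) => az2.
    left; exists z; have := dist_triangle w z b; have := dist_triangle w' z c.
    by rewrite (dist_sym z w) => *; split; lia.
  by right; exists w, z, w'; split; split => //; lia.
have case2 (a b c : V) : d a b = 2 -> d a c = 2 -> (d b c <= 1)%N ->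
    exists z, [/\ (d a z + 2 <= 2)%N, (d z b <= 2)%N & (d z c <= 2)%N].
  by move=> ab ac bc; exists a; rewrite distxx ab ac.
have case3 (a b c : V) : d a b = 3 -> d a c = 3 -> (d b c <= 1)%N ->
    exists z, [/\ (d a z + 2 <= 3)%N, (d z b <= 2)%N & (d z c <= 2)%N].
  move=> ab ac bc.
  have [//|[w [z [w' [[wb wz zw' wc] [aw az aw' bw']]]]]] :=
    step 1 _ _ _ ab ac bc.
  have [s [sw as_]] := parent _ _ _ aw.
  have sb := dist_triangle w s b.
  case: (leqP (d s w') 2) => sw'.
    exists s; split; [lia|lia|].
    (* [c] lies between [b] and [w'], both within distance 2 of [s]. *)
    apply: (@ball_between _ _ b w'); [|lia|lia].
    by rewrite (dist_sym c); lia.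
  (* Now a lies between s and w', both within distance 2 of b, although
     d a b = 3. *)
  have: (d b a <= 2)%N.
    apply: (@ball_between _ _ s w'); last 2 first.
    - by rewrite dist_sym; lia.
    - by lia.
    by rewrite (dist_sym s a); lia.
  by rewrite dist_sym ab.
elim: k x y => [//|[//|[|[|k]]] IH] x y _ ux uy xy.
- exact: case2.
- exact: case3.
have [//|[w [z [w' [[wx wz zw' wy] [uw uz uw' xw']]]]]] :=
  step _ _ _ _ ux uy xy.
have wz1 : (d w z <= 1)%N by rewrite wz.
(* Induction on the edge [w z] of the pentagon. The resulting [s] is at distance 3 from both [x] and
   [y], so the case of distance 3, based at [s], finishes one step away from [s]. *)
have [s [us sw sz]] := IH w z isT uw uz wz1.
have sx := dist_triangle w s x; have sw' := dist_triangle z s w'.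
have sy : (d s y <= 3)%N.
  apply: (@ball_between _ _ x w'); [|lia|lia].
  by rewrite (dist_sym y); lia.
have usx := dist_triangle s u x; have usy := dist_triangle s u y.
have [|||z0 [sz0 zx zy]] := case3 s x y; [lia|lia|by []|].
by exists z0; have := dist_triangle s u z0; split; lia.
Qed.

(* The hypotheses say that x and y lie in the same slice of the interval
   between u and v. *)
Lemma common_parent u v a x y : d u x = a.+1 -> d u y = a.+1 ->
  (d x v + a.+1 <= d u v)%N -> (d y v + a.+1 <= d u v)%N -> (d x y <= 1)%N ->
  exists z, [/\ (d u z <= a)%N, (d z x <= 1)%N & (d z y <= 1)%N].
Proof.
case: a => [|a] ux uy xv yv xy; first by exists u; rewrite distxx ux uy.
have [//|z [uz zx zy]] := grandparent_adjacent _ ux uy xy.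
have := dist_triangle z u x; have := dist_triangle z u y => zy' zx'.
have [w [zw wx]] : exists w, d z w = 1 /\ d w x = 1 by apply: midpoint; lia.
have [w' [zw' wy]] : exists w, d z w = 1 /\ d w y = 1 by apply: midpoint; lia.
have uw := dist_triangle z u w; have uw' := dist_triangle z u w'.
(* Seen from [v], both [w] and [w'] are thus parents of [z], hence adjacent; the square [w x y w']
   then has a chord. *)
have vz : d v z = (d v x).+2.
  have := dist_triangle x z v; have := dist_triangle z u v.
  by rewrite (dist_sym v z) (dist_sym v x); lia.
have vw := dist_triangle x v w; have vw' := dist_triangle y v w'.
have xuv := dist_triangle x u v; have yuv := dist_triangle y u v.
have xw : d x w = 1 by rewrite dist_sym.
have yw' : d y w' = 1 by rewrite dist_sym.
rewrite (dist_sym v x) in vz vw; rewrite (dist_sym v y) in vw'.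
have ww : (d w w' <= 1)%N.
  by apply: (parents_adjacent vz); rewrite ?zw ?zw' //; lia.
have [||||h|h] := @square_chord w x y w'; rewrite ?wx ?yw' //.
- by rewrite dist_sym.
- by exists w; split; lia.
by exists w'; split; rewrite 1?(dist_sym w'); lia.
Qed.

(** Induction along an enumeration of the clique. The vertex [z] found so far and a common parent
    [t] of [x0] and the new vertex [y] are both parents of [x0], hence adjacent; if [z] misses [y],
    the square [t y x z] makes [t] adjacent to every earlier [x]. *)
Lemma common_parent_clique u v a (K : set V) : K !=set0 -> finite_set K ->
  (forall x y, K x -> K y -> (d x y <= 1)%N) ->
  (forall x, K x -> d u x = a.+1) ->
  (forall x, K x -> (d x v + a.+1 <= d u v)%N) ->
  exists z, (d u z <= a)%N /\ forall x, K x -> (d z x <= 1)%N.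
Proof.
move=> [x0 Kx0] /finite_seqP[s Ks] Kcl Ku Kv.
suff [z [uz zP]] : exists z, (d u z <= a)%N /\
    forall x, x \in x0 :: s -> K x -> (d z x <= 1)%N.
  exists z; split => // x Kx; apply: zP => //; rewrite inE; apply/orP; right.
  by move: Kx; rewrite Ks.
elim: s {Ks} => [|y s [z [uz zP]]].
  have xx : (d x0 x0 <= 1)%N by rewrite distxx.
  have [ux vx] := (Ku _ Kx0, Kv _ Kx0).
  have [z [uz zx _]] := common_parent ux ux vx vx xx.
  by exists z; split => // x; rewrite inE => /eqP->.
case: (pselect (K y)) => [Ky|nKy]; last first.
  exists z; split => // x; rewrite !inE => /or3P[/eqP->|/eqP->|xs] Kx //.
    by apply: zP; rewrite ?inE ?eqxx.
  by apply: zP => //; rewrite inE xs orbT.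
have zx0 : (d z x0 <= 1)%N by apply: zP => //; rewrite inE eqxx.
have [t [ut tx ty]] := common_parent (Ku _ Kx0) (Ku _ Ky) (Kv _ Kx0) (Kv _ Ky)
  (Kcl _ _ Kx0 Ky).
have zt : (d z t <= 1)%N.
  by apply: (parents_adjacent (Ku _ Kx0)) => //; rewrite dist_sym.
case: (leqP (d z y) 1) => zy.
  exists z; split => // x; rewrite !inE => /or3P[/eqP->|/eqP->|xs] Kx //.
  by apply: zP => //; rewrite inE xs orbT.
exists t; split => // x; rewrite !inE => /or3P[/eqP->|/eqP->|xs] Kx //.
have zx : (d z x <= 1)%N by apply: zP => //; rewrite inE xs orbT.
have [||||h|h] := @square_chord t y x z; rewrite // ?(dist_sym x) //.
- exact: Kcl.
- by move: zy; rewrite dist_sym; lia.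
Qed.


(** * Normal cliques are nonempty cliques on spheres *)

Hypothesis e_fin : finite_cliques e.
Local Notation K := (ncliqueR e).

Lemma clique_close (S : set V) : (forall x y, S x -> S y -> (d x y <= 1)%N) ->
  clique e S.
Proof.
move=> S1 x y Sx Sy xy; apply: edge_dist; have := S1 _ _ Sx Sy.
by case E: (d x y) => [|[|//]] // _; case: xy; exact: dist_eq0.
Qed.

Lemma finite_close (S : set V) : (forall x y, S x -> S y -> (d x y <= 1)%N) ->
  finite_set S.
Proof. by move=> S1; apply: e_fin; exact: clique_close. Qed.

(** The claims need a joint induction: a common parent at level [j.+1] exists because level [j] is a
    finite clique on a sphere about [u], and level [j.+1] is a clique because it consists of parents
    of one vertex [p0]. *)
Lemma ncliqueR_spec u v j : (j <= d u v)%N ->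
  [/\ K u v j !=set0,
      forall x, K u v j x -> (d u x + j)%N = d u v /\ d x v = j &
      forall x y, K u v j x -> K u v j y -> (d x y <= 1)%N].
Proof.
elim: j => [_|j IH ju].
  split; first by exists v.
  - by move=> x /= ->; rewrite addn0 distxx.
  - by move=> x y /= -> ->; rewrite distxx.
have [K0 Kd K1] := IH (ltnW ju).
have [a Ea] : exists a, d u v = (a + j.+1)%N by exists (d u v - j.+1)%N; lia.
have [p0 Kp0] := K0; have [up0 p0v] := Kd _ Kp0.
have Sd x : K u v j.+1 x -> (d u x + j.+1)%N = d u v /\ d x v = j.+1.
  move=> [/(_ _ Kp0) p0x] /=; rewrite /ball /= in p0x * => ux.
  have := dist_triangle x u v; have := dist_triangle p0 x v.
  by rewrite (dist_sym x p0); lia.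
split=> // [|x y Kx Ky]; last first.
  have [ux _] := Sd _ Kx; have [uy _] := Sd _ Ky.
  have p0x : (d p0 x <= 1)%N by apply: Kx.1.
  have p0y : (d p0 y <= 1)%N by apply: Ky.1.
  by apply: (@parents_adjacent u a p0) => //; lia.
have [||s [us sK]] := @common_parent_clique u v a _ K0 (finite_close K1) K1.
- by move=> x /Kd; lia.
- by move=> x /Kd; lia.
exists s; split; last by rewrite /ball /=; lia.
by move=> p Kp; rewrite /ball /= dist_sym; exact: sK.
Qed.

Lemma ncliqueR_neq0 u v j : (j <= d u v)%N -> K u v j !=set0.
Proof. by case/ncliqueR_spec. Qed.

Lemma ncliqueR_dist u v j x : (j <= d u v)%N -> K u v j x ->
  (d u x + j)%N = d u v /\ d x v = j.
Proof. by case/ncliqueR_spec => _ + _; exact. Qed.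

Lemma ncliqueR_clique u v j x y : (j <= d u v)%N -> K u v j x -> K u v j y ->
  (d x y <= 1)%N.
Proof. by case/ncliqueR_spec => _ _; exact. Qed.

Lemma ncliqueR_consecutive u v j x y : K u v j x -> K u v j.+1 y ->
  (d x y <= 1)%N.
Proof. by move=> Kx [] /(_ _ Kx). Qed.

Lemma ncliqueR_intro u v j p : (d u p + j.+1 <= d u v)%N ->
  (forall x, K u v j x -> (d p x <= 1)%N) -> K u v j.+1 p.
Proof.
move=> up pK; split; last by rewrite /ball /=; lia.
by move=> x Kx; rewrite /ball /= dist_sym; exact: pK.
Qed.

(** * Moving the target *)

Local Notation C := (nclique e).

(* B^*_1 reverses inclusions, hence the alternation. *)
Lemma nclique_alternate u v v' i : d u v = (d u v').+1 -> (d v v' <= 1)%N ->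
  (i <= d u v')%N ->
  if odd (d u v' - i) then C u v i `<=` C u v' i else C u v' i `<=` C u v i.
Proof.
move=> uv vv' iv'; rewrite /nclique uv subSn //.
elim: (d u v' - i)%N => [|j].
  move=> _ ->; apply: ncliqueR_intro => [|x ->]; first by rewrite uv addn1.
  by rewrite dist_sym.
rewrite oddS; case: (odd j) => sub x [xK xu]; split.
- by move=> p /sub; exact: xK.
- by move: xu; rewrite uv subSS.
- by move=> p /sub; exact: xK.
- by move: xu; rewrite uv subSS.
Qed.

Lemma nclique_dist u v i x : C u v i x -> (i <= d u v)%N -> d u x = i.
Proof. by move=> /ncliqueR_dist []; first exact: leq_subr; lia. Qed.

Lemma nclique_distr u v i x : C u v i x -> d x v = (d u v - i)%N.
Proof. by move=> /ncliqueR_dist []; first exact: leq_subr. Qed.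

Lemma nclique_clique u v i x y : C u v i x -> C u v i y -> (d x y <= 1)%N.
Proof. by apply: ncliqueR_clique; exact: leq_subr. Qed.

Lemma nclique_neq0 u v i : C u v i !=set0.
Proof. by apply: ncliqueR_neq0; exact: leq_subr. Qed.

Lemma nclique_target_closer u v v' i x y : d u v = (d u v').+1 ->
  (d v v' <= 1)%N -> C u v i x -> C u v' i y -> (d x y <= 1)%N.
Proof.
move=> uv vv' Cx Cy; case: (leqP i (d u v')) => iv.
  have := nclique_alternate uv vv' iv; case: odd => sub.
    by apply: (nclique_clique (sub _ Cx) Cy).
  by apply: (nclique_clique Cx (sub _ Cy)).
have -> : x = v by apply: dist_eq0; rewrite (nclique_distr Cx); lia.
by have -> : y = v' by apply: dist_eq0; rewrite (nclique_distr Cy); lia.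
Qed.

(** The targets are joined by [v, w, z, w', v'], which descends two levels and climbs back, so four
    alternating inclusions compare the cliques of index [i]. *)
Lemma nclique_target_level u v v' i x y : d u v = d u v' ->
  (d v v' <= 1)%N -> C u v i x -> C u v' i y -> (d x y <= 3)%N.
Proof.
move=> uv vv' Cx Cy; have xv := nclique_distr Cx; have yv := nclique_distr Cy.
(* Close to the targets, [z] may be too low to reach index [i]; there the path from [x] through [v]
   and [v'] to [y] suffices. *)
case: (leqP (d u v - i) 1) => ki.
  have := dist_triangle v x y; have := dist_triangle v' v y.
  by rewrite (dist_sym v'); lia.
have k2 : (2 <= d u v)%N by lia.
have [z [uz zv zv']] := grandparent_adjacent k2 (erefl _) (esym uv) vv'.
have := dist_triangle z u v; have := dist_triangle z u v' => uzv' uzv.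
have [w [zw wv]] : exists w, d z w = 1 /\ d w v = 1 by apply: midpoint; lia.
have [w' [zw' wv']] : exists w, d z w = 1 /\ d w v' = 1 by apply: midpoint; lia.
have uw := dist_triangle z u w; have uw' := dist_triangle z u w'.
have uwv := dist_triangle w u v; have uwv' := dist_triangle w' u v'.
have Evw : d u v = (d u w).+1 by lia.
have Ev'w' : d u v' = (d u w').+1 by lia.
have Ewz : d u w = (d u z).+1 by lia.
have Ew'z : d u w' = (d u z).+1 by lia.
have iz : (i <= d u z)%N by lia.
have := nclique_alternate Evw _ (leq_trans iz _).
have := nclique_alternate Ev'w' _ (leq_trans iz _).
have := nclique_alternate Ewz _ iz; have := nclique_alternate Ew'z _ iz.
rewrite Ewz Ew'z !subSn //= !(dist_sym _ z) zw zw' !(dist_sym v) !(dist_sym v').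
rewrite wv wv' leqnSn => /(_ isT) + /(_ isT) + /(_ isT isT) + /(_ isT isT).
case: odd => /= w'z wz v'w' vw.
  (* The cliques towards [w] and [w'] are contained in all their neighbours in the chain, giving 1 +
     1 + 1. *)
  have [p Cp] := nclique_neq0 u w i; have [p' Cp'] := nclique_neq0 u w' i.
  have := nclique_clique Cx (vw _ Cp); have := nclique_clique (v'w' _ Cp') Cy.
  have := nclique_clique (wz _ Cp) (w'z _ Cp').
  have := dist_triangle p x y; have := dist_triangle p' p y; lia.
(* In the other parity the cliques towards [w] and [w'] contain their neighbours, and any [p]
   towards [z] is close to both [x] and [y]. *)
have [p Cp] := nclique_neq0 u z i.
have := nclique_clique (vw _ Cx) (wz _ Cp).
have := nclique_clique (w'z _ Cp) (v'w' _ Cy).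
have := dist_triangle p x y; lia.
Qed.

Lemma nclique_target u v v' i x y : (d v v' <= 1)%N ->
  C u v i x -> C u v' i y -> (d x y <= 3)%N.
Proof.
move=> vv' Cx Cy; have v'v : (d v' v <= 1)%N by rewrite dist_sym.
have := dist_triangle v u v'; have := dist_triangle v' u v => t1 t2.
case: (ltngtP (d u v) (d u v')) => uv; last exact: nclique_target_level Cx Cy.
  rewrite dist_sym; apply: leq_trans (nclique_target_closer _ v'v Cy Cx) _ => //.
  by lia.
by apply: leq_trans (nclique_target_closer _ vv' Cx Cy) _ => //; lia.
Qed.

(** * Moving the source *)

(* Adjacency of a single pair would not propagate from j to j+1; this
   disjunction does. *)
Lemma ncliqueR_source_closer u u' v j : d u v = (d u' v).+1 -> d u u' = 1 ->
  (j <= d u' v)%N ->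
  (exists p, K u v j p /\ K u' v j p) \/
  (forall x y, K u v j x -> K u' v j y -> (d x y <= 1)%N).
Proof.
move=> uv uu'; elim: j => [_|j IH ju]; first by left; exists v.
have ju' : (j <= d u v)%N by lia.
have ju1 : (j.+1 <= d u v)%N by lia.
have [a Ea] : exists a, d u' v = (a + j.+1)%N by exists (d u' v - j.+1)%N; lia.
have Kd' i y : (i <= d u' v)%N -> K u' v i y -> (d u y + i)%N = d u v.
  move=> iv Ky; have [u'y yv] := ncliqueR_dist iv Ky.
  by have := dist_triangle u' u y; have := dist_triangle y u v; lia.
have share p x y : K u v j p \/ K u' v j p ->
    K u v j.+1 x -> K u' v j.+1 y -> (d p x <= 1)%N -> (d p y <= 1)%N ->
    (d x y <= 1)%N.
  move=> Kp Kx Ky px py.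
  have [ux _] := ncliqueR_dist ju1 Kx; have uy := Kd' _ _ ju Ky.
  have up : d u p = a.+2.
    by case: Kp => [/(ncliqueR_dist ju')|/(Kd' _ _ (ltnW ju))]; lia.
  by apply: (parents_adjacent up) => //; lia.
case: (IH (ltnW ju)) => [[p [Kp K'p]]|Q].
  right=> x y Kx Ky; apply: (share p) => //; first by left.
    exact: ncliqueR_consecutive Kp Kx.
  exact: ncliqueR_consecutive K'p Ky.
have u'K x : K u v j x -> (d u' x <= a.+2)%N.
  move=> Kx; have [y Ky] := ncliqueR_neq0 (ltnW ju).
  have [u'y _] := ncliqueR_dist (ltnW ju) Ky; have := Q _ _ Kx Ky.
  by have := dist_triangle y u' x; rewrite (dist_sym y x); lia.
(* A vertex too far from [u'] makes the next slices completely joined. Without one, the union of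
   both cliques is a clique on one sphere about [u'], and its common parent lies in both next
   slices. *)
case: (pselect (exists2 x, K u v j x & d u' x = a.+2)) => [[x' Kx' u'x']|H].
  right=> x y Kx Ky; have [y' Ky'] := ncliqueR_neq0 (ltnW ju).
  have [u'y' _] := ncliqueR_dist (ltnW ju) Ky'.
  have x'x := ncliqueR_consecutive Kx' Kx.
  apply: (share y') => //; [by right| |exact: ncliqueR_consecutive Ky' Ky].
  have [ux xv] := ncliqueR_dist ju1 Kx.
  have [t tu t'] : exists2 t, d u t = 1 & d t x = a.
    have /dist_succ[t []] : d u x = a.+1 by lia.
    by exists t.
  (* Seen from [v], both [u'] and [t] are parents of [u]. *)
  have u't : (d u' t <= 1)%N.
    apply: (@parents_adjacent v (a + j.+1)%N u); rewrite ?uu' ?tu //.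
    - by rewrite dist_sym; lia.
    - by rewrite dist_sym; lia.
    - by have := dist_triangle x t v; rewrite (dist_sym v t); lia.
  have := dist_triangle t u' x => u'x.
  by apply: (parents_adjacent u'x') => //; [lia|lia|exact: Q].
have u'K1 x : K u v j x -> d u' x = a.+1.
  move=> Kx; have := u'K _ Kx; have [_ xv] := ncliqueR_dist ju' Kx.
  have : d u' x <> a.+2 by move=> E; apply: H; exists x.
  by have := dist_triangle x u' v; lia.
left; pose S : set V := K u v j `|` K u' v j.
have S0 : S !=set0 by have [x Kx] := ncliqueR_neq0 ju'; exists x; left.
have S1 x y : S x -> S y -> (d x y <= 1)%N.
  move=> [Sx|Sx] [Sy|Sy].
  - exact: ncliqueR_clique Sx Sy.
  - exact: Q.
  - by rewrite dist_sym; exact: Q.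
  - exact: ncliqueR_clique (ltnW ju) Sx Sy.
have [||s [us sS]] := @common_parent_clique u' v a S S0 (finite_close S1) S1.
- move=> x [/u'K1 //|/(ncliqueR_dist (ltnW ju))]; lia.
- by move=> x [/(ncliqueR_dist ju')|/(ncliqueR_dist (ltnW ju))]; lia.
have := dist_triangle u' u s => us'.
exists s; split; apply: ncliqueR_intro; try lia.
  by move=> x Kx; apply: sS; left.
by move=> x Kx; apply: sS; right.
Qed.

(* The final edge u u' keeps the two sides from drifting apart once they have
   separated. *)
Lemma separated_step u u' m x y x1 y1 : d u u' = 1 ->
  d u x = m.+1 -> d u' x = m.+2 -> d u' y = m.+1 -> d u y = m.+2 ->
  (d x y <= 2)%N -> (d x x1 <= 1)%N -> (d u x1 <= m)%N ->
  (d y y1 <= 1)%N -> (d u' y1 <= m)%N -> (d x1 y1 <= 2)%N.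
Proof.
have half a a' b b1 c1 : d a a' = 1 -> d a' b = m.+2 -> (d b b1 <= 1)%N ->
    (d a b1 <= m)%N -> (d a' c1 <= m)%N -> (d b c1 <= 2)%N -> (d b1 c1 <= 2)%N.
  move=> aa' a'b bb1 ab1 a'c1 bc1; have a'b1 := dist_triangle a a' b1.
  rewrite (dist_sym a' a) aa' in a'b1.
  have := dist_triangle c1 a' b; rewrite (dist_sym c1) => t.
  (* Seen from [a'], both the midpoint [c] and [b1] are parents of [b], hence adjacent. *)
  have /midpoint[c [bc cc1]] : d b c1 = 2 by lia.
  have := dist_triangle c1 a' c; rewrite (dist_sym c1) => t'.
  have : (d b1 c <= 1)%N by apply: (parents_adjacent a'b) => //; lia.
  by have := dist_triangle c b1 c1; lia.
move=> uu' ux u'x u'y uy xy xx1 ux1 yy1 u'y1.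
have u'u : d u' u = 1 by rewrite dist_sym.
have viaL : (d x y1 <= 2)%N -> (d x1 y1 <= 2)%N by apply: (half u u').
have viaR : (d x1 y <= 2)%N -> (d x1 y1 <= 2)%N.
  by move=> h; rewrite dist_sym; apply: (half u' u) yy1 _ _ _ => //;
    rewrite dist_sym.
have := dist_triangle u u' x1; have := dist_triangle u' u y1 => uy1 u'x1.
case: (leqP (d x y) 1) => xy1.
  have : (d x1 y <= 1)%N by apply: (parents_adjacent u'x) => //; lia.
  by move=> h; apply: viaR; lia.
have /midpoint[c [xc cy]] : d x y = 2 by lia.
(* If [c] is outside the ball about [u], it cannot lie between [x] and [y1], which forces
   [d x y1 <= 2]; likewise for [u']. If [c] is in both balls, it links [x1] to [y1]. *)
case: (leqP (d u c) m.+1) => uc; last first.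
  apply: viaL; case: (leqP (d x y1) 2) => // h.
  have := dist_triangle y c y1 => t.
  have : (d u c <= m.+1)%N by apply: (@ball_between _ _ x y1); lia.
  by lia.
case: (leqP (d u' c) m.+1) => u'c; last first.
  apply: viaR; rewrite dist_sym; case: (leqP (d y x1) 2) => // h.
  have := dist_triangle x c x1; rewrite (dist_sym c x) => t.
  have : (d u' c <= m.+1)%N.
    by apply: (@ball_between _ _ y x1); rewrite ?(dist_sym y c); lia.
  by lia.
have x1c : (d x1 c <= 1)%N by apply: (parents_adjacent u'x) => //; lia.
have yc : (d y c <= 1)%N by rewrite dist_sym; lia.
have : (d c y1 <= 1)%N by apply: (parents_adjacent uy) => //; lia.
by have := dist_triangle c x1 y1; lia.
Qed.

(** For [u] and [u'] equidistant from [v], [x] is one step farther from [u'] than from [u], and [y]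
    one step farther from [u] than from [u']; sums avoid truncated differences. *)
Definition separated u u' v j := exists x y, [/\ K u v j x, K u' v j y &
  [/\ (d u' x + j)%N = (d u' v).+1, (d u y + j)%N = (d u v).+1 &
      (d x y <= 2)%N]].

Lemma separated_sym u u' v j : separated u u' v j -> separated u' u v j.
Proof.
move=> [x [y [Kx Ky [u'x uy xy]]]]; exists y, x; split => //.
by split; rewrite // dist_sym.
Qed.

(** Induction away from [v]: a shared vertex leads to a complete join or to separation, a complete
    join to any of the three, and separation to itself. *)
Lemma ncliqueR_source_level u u' v j : d u v = d u' v -> d u u' = 1 ->
  (j <= d u v)%N ->
  [\/ exists p, K u v j p /\ K u' v j p,
      forall x y, K u v j x -> K u' v j y -> (d x y <= 1)%N |
      separated u u' v j].
Proof.
have step w w' i : d w v = d w' v -> d w w' = 1 -> (i.+1 <= d w v)%N ->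
    separated w w' v i -> separated w w' v i.+1.
  move=> wv ww' iv [x [y [Kx Ky [w'x wy xy]]]].
  have iv' : (i.+1 <= d w' v)%N by lia.
  have [x1 Kx1] := ncliqueR_neq0 iv; have [y1 Ky1] := ncliqueR_neq0 iv'.
  have xx1 := ncliqueR_consecutive Kx Kx1.
  have yy1 := ncliqueR_consecutive Ky Ky1.
  have [wx _] := ncliqueR_dist (ltnW iv) Kx.
  have [w'y _] := ncliqueR_dist (ltnW iv') Ky.
  have [wx1 _] := ncliqueR_dist iv Kx1; have [w'y1 _] := ncliqueR_dist iv' Ky1.
  have [m Em] : exists m, d w v = (m + i.+1)%N by exists (d w v - i.+1)%N; lia.
  have := dist_triangle x1 w' x; rewrite (dist_sym x1) => w'x1.
  have := dist_triangle y1 w y; rewrite (dist_sym y1) => wy1.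
  have := dist_triangle w w' x1; rewrite (dist_sym w' w) => w'x1'.
  have := dist_triangle w' w y1 => wy1'.
  exists x1, y1; split => //; split; [lia|lia|].
  by apply: (@separated_step w w' m x y) => //; lia.
(* Only the clique from [w] has a vertex farther from the other source. Its next slice is then
   completely joined to [y'], and the outcome depends on whether the next slice from [w'] has a
   vertex farther from [w]. *)
have half w w' i : d w v = d w' v -> d w w' = 1 -> (i.+1 <= d w v)%N ->
    (forall x y, K w v i x -> K w' v i y -> (d x y <= 1)%N) ->
    (exists2 x, K w v i x & (d w' x + i)%N = (d w' v).+1) ->
    (forall y, K w' v i y -> (d w y + i)%N = d w v) ->
    (forall x y, K w v i.+1 x -> K w' v i.+1 y -> (d x y <= 1)%N) \/
    separated w w' v i.+1.
  move=> wv ww' iv Q [x' Kx' w'x'] K'w.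
  have iv' : (i.+1 <= d w' v)%N by lia.
  have [m Em] : exists m, d w v = (m + i.+1)%N by exists (d w v - i.+1)%N; lia.
  have [y' Ky'] := ncliqueR_neq0 (ltnW iv').
  have [w'y' _] := ncliqueR_dist (ltnW iv') Ky'; have wy' := K'w _ Ky'.
  have w'K x : K w v i.+1 x -> d w' x = m.+1.
    move=> Kx; have x'x := ncliqueR_consecutive Kx' Kx.
    have [wx _] := ncliqueR_dist iv Kx.
    have := dist_triangle w w' x; rewrite (dist_sym w' w) ww'.
    by have := dist_triangle x w' x'; rewrite (dist_sym x); lia.
  have y'K x : K w v i.+1 x -> (d y' x <= 1)%N.
    move=> Kx; have x'x := ncliqueR_consecutive Kx' Kx.
    have E : d w' x' = m.+2 by lia.
    by apply: (parents_adjacent E); rewrite ?(w'K x) //; [lia|exact: Q].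
  case: (pselect (exists2 y, K w' v i.+1 y & (d w y + i.+1)%N = (d w v).+1)).
    move=> [y Ky wy]; right; have [x Kx] := ncliqueR_neq0 iv.
    exists x, y; split => //; split; [by rewrite (w'K x) //; lia|by []|].
    have := ncliqueR_consecutive Ky' Ky; have := y'K _ Kx.
    by have := dist_triangle y' x y; rewrite (dist_sym x y'); lia.
  move=> H; left=> x y Kx Ky; have E : d w y' = m.+1 by lia.
  have [wx _] := ncliqueR_dist iv Kx; have [w'y yv] := ncliqueR_dist iv' Ky.
  have wy : (d w y + i.+1)%N <> (d w v).+1 by move=> h; apply: H; exists y.
  have := dist_triangle y w v; have := dist_triangle w' w y => t1 t2.
  apply: (parents_adjacent E); [lia|lia|exact: y'K|].
  exact: ncliqueR_consecutive Ky' Ky.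
move=> uv uu'; have u'u : d u' u = 1 by rewrite dist_sym.
elim: j => [_|j IH ju]; first by constructor 1; exists v.
have ju' : (j.+1 <= d u' v)%N by lia.
have [m Em] : exists m, d u v = (m + j.+1)%N by exists (d u v - j.+1)%N; lia.
have Kd i x : (i <= d u v)%N -> K u v i x -> (d u' x + i)%N <> (d u' v).+1 ->
    (d u' x + i)%N = d u' v.
  move=> iv Kx nx; have [ux xv] := ncliqueR_dist iv Kx.
  have := dist_triangle x u' v; have := dist_triangle u u' x; lia.
have Kd' i x : (i <= d u' v)%N -> K u' v i x -> (d u x + i)%N <> (d u v).+1 ->
    (d u x + i)%N = d u v.
  move=> iv Kx nx; have [ux xv] := ncliqueR_dist iv Kx.
  have := dist_triangle x u v; have := dist_triangle u' u x; lia.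
case: (pselect (separated u u' v j.+1)) => [|nT1]; first by constructor 3.
case: (IH (ltnW ju)) => [[p [Kp K'p]]|Q|T]; last first.
- by constructor 3; exact: step.
- case: (pselect (exists2 x, K u v j x & (d u' x + j)%N = (d u' v).+1)) => Hx;
  case: (pselect (exists2 y, K u' v j y & (d u y + j)%N = (d u v).+1)) => Hy.
  (* Both sides have a far vertex, so level [j] is already separated. *)
  + case: Hx Hy => [x Kx u'x] [y Ky uy]; constructor 3; apply: step => //.
    by exists x, y; split => //; split => //; apply: leq_trans (Q _ _ Kx Ky) _.
  + have [|H|H] := half u u' j uv uu' ju Q Hx; [|by constructor 2|by []].
    move=> y Ky; apply: Kd' => //; [exact: ltnW|] => h.
    by apply: Hy; exists y.
  + have [||H|/separated_sym//] := half u' u j (esym uv) u'u ju' _ Hy.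
    * by move=> x y Kx Ky; rewrite dist_sym; exact: Q.
    * move=> x Kx; apply: Kd => //; [exact: ltnW|] => h.
      by apply: Hx; exists x.
    * by constructor 2 => x y Kx Ky; rewrite dist_sym; exact: H.
  have {}Hx x : K u v j x -> d u' x = m.+1.
    move=> Kx; suff: (d u' x + j)%N = d u' v by lia.
    by apply: Kd => //; [exact: ltnW|] => h; apply: Hx; exists x.
  have {}Hy y : K u' v j y -> d u y = m.+1.
    move=> Ky; suff: (d u y + j)%N = d u v by lia.
    by apply: Kd' => //; [exact: ltnW|] => h; apply: Hy; exists y.
  (* The union is a clique on a sphere about [u] and on one about [u']. Of its common parents [s]
     and [s'] on the two sides, one lies in both next slices, or they are separated, at distance at
     most 2 through [p]. *)
  pose S : set V := K u v j `|` K u' v j.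
  have [p Kp] := ncliqueR_neq0 (ltnW ju).
  have S0 : S !=set0 by exists p; left.
  have S1 x y : S x -> S y -> (d x y <= 1)%N.
    move=> [Sx|Sx] [Sy|Sy].
    - exact: ncliqueR_clique (ltnW ju) Sx Sy.
    - exact: Q.
    - by rewrite dist_sym; exact: Q.
    - exact: ncliqueR_clique (ltnW ju') Sx Sy.
  have [||s [us sS]] := @common_parent_clique u v m S S0 (finite_close S1) S1.
  + by move=> x [/(ncliqueR_dist (ltnW ju))|/Hy]; lia.
  + move=> x [/(ncliqueR_dist (ltnW ju))|/(ncliqueR_dist (ltnW ju'))]; lia.
  have [||s' [us' sS']] :=
    @common_parent_clique u' v m S S0 (finite_close S1) S1.
  + by move=> x [/Hx|/(ncliqueR_dist (ltnW ju'))]; lia.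
  + move=> x [/(ncliqueR_dist (ltnW ju))|/(ncliqueR_dist (ltnW ju'))]; lia.
  have Ks : K u v j.+1 s.
    by apply: ncliqueR_intro => [|x Kx]; [lia|apply: sS; left].
  have Ks' : K u' v j.+1 s'.
    by apply: ncliqueR_intro => [|x Kx]; [lia|apply: sS'; right].
  case: (leqP (d u' s) m) => u's.
    constructor 1; exists s; split => //.
    by apply: ncliqueR_intro => [|x Kx]; [lia|apply: sS; right].
  case: (leqP (d u s') m) => us'2.
    constructor 1; exists s'; split => //.
    by apply: ncliqueR_intro => [|x Kx]; [lia|apply: sS'; left].
  case: nT1; exists s, s'; split => //.
  have := dist_triangle u u' s; have := dist_triangle u' u s' => t1 t2.
  have sp : (d s p <= 1)%N by apply: sS; left.
  have s'p : (d s' p <= 1)%N by apply: sS'; left.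
  have := dist_triangle p s s'; rewrite (dist_sym p) => t3.
  by split; lia.
(* Unless [x] and [y] are both far from the opposite source, which is separation, they are parents
   of the shared [p] as seen from one source. *)
constructor 2 => x y Kx Ky.
have px := ncliqueR_consecutive Kp Kx; have py := ncliqueR_consecutive K'p Ky.
have [ux _] := ncliqueR_dist ju Kx; have [u'y _] := ncliqueR_dist ju' Ky.
have [up _] := ncliqueR_dist (ltnW ju) Kp.
have [u'p _] := ncliqueR_dist (ltnW ju') K'p.
have up1 : d u p = m.+1 by lia.
have u'p1 : d u' p = m.+1 by lia.
case: (eqVneq (d u' x + j.+1)%N (d u' v).+1) => [u'x|/eqP/(Kd _ _ ju Kx) u'x].
  case: (eqVneq (d u y + j.+1)%N (d u v).+1) => [uy|/eqP/(Kd' _ _ ju' Ky) uy].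
    case: nT1; exists x, y; split => //; split => //.
    by have := dist_triangle p x y; rewrite (dist_sym x p); lia.
  by apply: (parents_adjacent up1) => //; lia.
by apply: (parents_adjacent u'p1) => //; lia.
Qed.

Lemma nclique_source_closer u u' v i x y : d u v = (d u' v).+1 -> d u u' = 1 ->
  C u v i x -> C u' v i y -> (d x y <= 3)%N.
Proof.
move=> uv uu' Cx Cy; case: i Cx Cy => [|i] Cx Cy.
  have <- : u = x by apply: dist_eq0; apply: nclique_dist Cx _.
  have <- : u' = y by apply: dist_eq0; apply: nclique_dist Cy _.
  by rewrite uu'.
move: Cx Cy; rewrite /nclique uv subSS.
(* Index [i.+1] is level [j] from [u] but level [j.-1] from [u']; a vertex [z] of level [j] from
   [u'] bridges the shift. *)
set j := (d u' v - i)%N; case: (leqP (d u' v) i) => [ui|ui].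
  have -> : j = 0 by apply/eqP; rewrite subn_eq0.
  have -> : (d u' v - i.+1)%N = 0 by lia.
  by move=> -> ->; rewrite distxx.
have ju : (j <= d u' v)%N by rewrite leq_subr.
have -> : (d u' v - i.+1)%N = j.-1 by lia.
have j0 : j = j.-1.+1 by lia.
have [z Kz] := ncliqueR_neq0 ju.
move=> Kx Ky; have := Kz; rewrite {1}j0 => Kz1.
have := ncliqueR_consecutive Ky Kz1.
case: (ncliqueR_source_closer uv uu' ju) => [[p [Kp K'p]]|/(_ _ _ Kx Kz)].
  have jv : (j <= d u v)%N by lia.
  have := ncliqueR_clique jv Kx Kp; have := ncliqueR_clique ju K'p Kz.
  have := dist_triangle z x y; have := dist_triangle p x z.
  by rewrite (dist_sym y z); lia.
by have := dist_triangle z x y; rewrite (dist_sym y z); lia.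
Qed.

(** The worst case is separation: a gap of 2 plus diameter 1 on each side. *)
Lemma nclique_source_level u u' v i x y : d u v = d u' v -> d u u' = 1 ->
  C u v i x -> C u' v i y -> (d x y <= 4)%N.
Proof.
move=> uv uu'; rewrite /nclique -uv.
have := leq_subr i (d u v); move: (d u v - i)%N => j ju Kx Ky.
have ju' : (j <= d u' v)%N by rewrite -uv.
have Q := ncliqueR_clique ju Kx; have Q' := ncliqueR_clique ju'.
case: (ncliqueR_source_level uv uu' ju) => [[p [Kp K'p]]|/(_ _ _ Kx Ky)|].
- by have := Q _ Kp; have := Q' _ _ K'p Ky; have := dist_triangle p x y; lia.
- by lia.
move=> [a [b [Ka Kb [_ _ ab]]]]; have := Q _ Ka; have := Q' _ _ Kb Ky.
by have := dist_triangle a x y; have := dist_triangle b a y; lia.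
Qed.

Lemma nclique_source u u' v i x y : d u u' = 1 ->
  C u v i x -> C u' v i y -> (d x y <= 4)%N.
Proof.
move=> uu' Cx Cy; have u'u : d u' u = 1 by rewrite dist_sym.
have := dist_triangle u' u v; have := dist_triangle u u' v => t1 t2.
case: (ltngtP (d u v) (d u' v)) => uv; last exact: nclique_source_level Cx Cy.
  rewrite dist_sym.
  by apply: leq_trans (nclique_source_closer _ u'u Cy Cx) _ => //; lia.
by apply: leq_trans (nclique_source_closer _ uu' Cx Cy) _ => //; lia.
Qed.

(** * Moving both endpoints *)

Lemma nclique_fellow_source n u u' v i x y : d u u' = n.+1 ->
  C u v i x -> C u' v i y -> (d x y <= 4 * n.+1)%N.
Proof.
elim: n u x => [|n IH] u x uu' Cx Cy; first exact: nclique_source Cx Cy.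
have [w [uw wu']] := dist_succ uu'; have [z Cz] := nclique_neq0 w v i.
have := nclique_source uw Cx Cz; have := IH _ _ wu' Cz Cy.
by have := dist_triangle z x y; lia.
Qed.

Lemma nclique_fellow_target n u v v' i x y : d v v' = n.+1 ->
  C u v i x -> C u v' i y -> (d x y <= 3 * n.+1)%N.
Proof.
elim: n v x => [|n IH] v x vv' Cx Cy.
  by apply: nclique_target Cx Cy; rewrite vv'.
have [w [vw wv']] := dist_succ vv'; have [z Cz] := nclique_neq0 u w i.
have vw1 : (d v w <= 1)%N by rewrite vw.
have := nclique_target vw1 Cx Cz; have := IH _ _ wv' Cz Cy.
by have := dist_triangle z x y; lia.
Qed.

(** Passing through [(u', v)] costs 4 per edge between the sources and 3 per edge between the
    targets. For equal pairs the bound would be 0, while one clique may contain two adjacent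
    vertices. *)
Lemma nclique_fellow u u' v v' i x y : (u, v) <> (u', v') ->
  C u v i x -> C u' v' i y -> (d x y <= 7 * maxn (d u u') (d v v'))%N.
Proof.
move=> neq Cx Cy; have [z Cz] := nclique_neq0 u' v i.
case uu' : (d u u') => [|n]; case vv' : (d v v') => [|m].
- by case: neq; rewrite (dist_eq0 uu') (dist_eq0 vv').
- rewrite (dist_eq0 uu') in Cx.
  by have := nclique_fellow_target vv' Cx Cy; lia.
- rewrite (dist_eq0 vv') in Cx.
  by have := nclique_fellow_source uu' Cx Cy; lia.
have := nclique_fellow_source uu' Cx Cz; have := nclique_fellow_target vv' Cz Cy.
by have := dist_triangle z x y; lia.
Qed.

Lemma nclique_fellow1 u u' v v' i x y : C u v i x -> C u' v' i y ->
  (d x y <= 7 * maxn (d u u') (d v v') + 1)%N.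
Proof.
move=> Cx Cy; case: (pselect ((u, v) = (u', v'))) => [[uu' vv']|neq].
  by subst u' v'; have := nclique_clique Cx Cy; lia.
by have := nclique_fellow neq Cx Cy; lia.
Qed.

(** * Normal clique-paths and normal paths as geodesics *)

Lemma nclique0 u v : C u v 0 = [set u].
Proof.
have sub x : C u v 0 x -> u = x.
  by move=> Cx; apply: dist_eq0; apply: nclique_dist Cx _.
have [x Cx] := nclique_neq0 u v 0; apply/seteqP; split=> y /=.
  by move/sub.
by move=> ->; rewrite {2}(sub _ Cx).
Qed.

Lemma nclique_ge u v i : (d u v <= i)%N -> C u v i = [set v].
Proof. by rewrite -subn_eq0 /nclique => /eqP ->. Qed.

Lemma nclique_consecutive u v i x y : (i < d u v)%N ->
  C u v i x -> C u v i.+1 y -> d x y = 1.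
Proof.
move=> iu Cx Cy; have ux := nclique_dist Cx (ltnW iu).
have uy := nclique_dist Cy iu.
have := dist_triangle x u y.
suff: (d y x <= 1)%N by rewrite dist_sym; lia.
move: Cx Cy; rewrite /nclique.
have -> : (d u v - i)%N = (d u v - i.+1).+1 by lia.
by move=> Kx Ky; exact: ncliqueR_consecutive Ky Kx.
Qed.

Lemma cdist_le A B n : (forall x y, A x -> B y -> (d x y <= n)%N) ->
  (cdist e A B <= n)%N.
Proof.
move=> ABn; rewrite /cdist.
(* For infinite support the iterated maximum has the default value 0. *)
case: finite_supportP => [_|X XP _ _]; first by rewrite big_nil.
by apply/bigmax_leqP_seq => -[x y] /XP[Ax By] _; exact: ABn.
Qed.

Lemma cdist_set1 x y : cdist e [set x] [set y] = d x y.
Proof.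
rewrite /cdist; have -> : [set x] `*` [set y] = [set (x, y)].
  by apply/seteqP; split=> [[a b] /= [-> ->]|_ -> /=].
by rewrite fsbig_set1.
Qed.

Local Notation gamma := (normal_clique_path e).

Lemma plen_normal_clique_path u v : plen (gamma u v) = d u v.
Proof. by rewrite /plen size_map size_iota. Qed.

(** The truncated subtraction in [nclique] gives [[set v]] beyond the end, in agreement with the
    extension in [pat]. *)
Lemma pat_normal_clique_path u v i : pat (gamma u v) i = C u v i.
Proof.
rewrite (pat_map (C u v)); case: (leqP i (d u v)) => // /ltnW ui.
by rewrite !nclique_ge.
Qed.

Lemma pstart_normal_clique_path u v : pstart (gamma u v) = [set u].
Proof. exact: nclique0. Qed.

Lemma pend_normal_clique_path u v : pend (gamma u v) = [set v].
Proof.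
by rewrite -pat_plen plen_normal_clique_path pat_normal_clique_path nclique_ge.
Qed.

Lemma normal_path_nclique u v g i : normal_path e u v g -> C u v i (pat g i).
Proof.
move=> [_ _ gv gn gC]; case: (leqP i (d u v)) => ui.
  by have := gC _ ui; rewrite pat_normal_clique_path.
by rewrite pat_ge ?gn ?gv 1?ltnW // nclique_ge // ltnW.
Qed.

(** Consecutive cliques are completely joined, so the distance to [u] grows by at most one per
    clique. *)
Lemma dist_le_clique_path h u v : is_clique_path e h ->
  pstart h = [set u] -> pend h = [set v] -> (d u v <= plen h)%N.
Proof.
move=> [hne hcl] hu hv.
suff H i x : (i <= plen h)%N -> pat h i x -> (d u x <= i)%N.
  by apply: H => //; rewrite pat_plen hv.
elim: i x => [x _|i IH x ih hx].
  by rewrite /pat /= -[h.1]/(pstart h) hu => ->; rewrite distxx.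
have [[y hy] _] := hne i; have [_ cl] := hcl _ ih.
have := IH _ (ltnW ih) hy; have := dist_triangle y u x.
suff : (d y x <= 1)%N by lia.
case: (pselect (y = x)) => [->|yx]; first by rewrite distxx.
by rewrite dist_edge //; apply: cl => //; [left|right].
Qed.

Lemma normal_clique_path_shortest u v :
  shortest (is_clique_path e) (gamma u v).
Proof.
split; last first.
  move=> h hP; rewrite pstart_normal_clique_path pend_normal_clique_path.
  by rewrite plen_normal_clique_path; exact: dist_le_clique_path.
split=> i; rewrite !pat_normal_clique_path.
  split; first exact: nclique_neq0.
  by apply: clique_close => x y; exact: nclique_clique.
rewrite plen_normal_clique_path => iu; split.
  apply/seteqP; split=> // x [Cx Cx']; have := nclique_consecutive iu Cx Cx'.
  by rewrite distxx.
apply: clique_close => x y [Cx|Cx] [Cy|Cy].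
- exact: nclique_clique Cx Cy.
- by rewrite (nclique_consecutive iu Cx Cy).
- by rewrite dist_sym (nclique_consecutive iu Cy Cx).
- exact: nclique_clique Cx Cy.
Qed.

(** Vertices can be chosen in the cliques independently, because consecutive cliques are completely
    joined. *)
Lemma normal_path_exists u v : exists g, normal_path e u v g.
Proof.
pose f i := sval (cid (nclique_neq0 u v i)).
have fC i : C u v i (f i) by rewrite /f; case: cid.
pose g : gpath V := (f 0, [seq f i | i <- iota 1 (d u v)]).
have gn : plen g = d u v by rewrite /plen size_map size_iota.
have gP i : (i <= d u v)%N -> pat g i = f i.
  by move=> iu; rewrite pat_map (minn_idPl iu).
exists g; split => //.
- apply/(pathP (pend g)) => i; rewrite -[size _]/(plen g) gn => iu.
  rewrite -[nth _ (_ :: _) i]/(pat g i) -[nth _ _ i]/(pat g i.+1).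
  rewrite !gP // ?(ltnW iu) //; apply: edge_dist.
  exact: nclique_consecutive iu (fC _) (fC _).
- by have := fC 0; rewrite nclique0.
- by have := fC (d u v); rewrite -gP // -gn pat_plen nclique_ge ?gn.
- by move=> i iu; rewrite gP // pat_normal_clique_path.
Qed.

Lemma normal_path_shortest u v g :
  normal_path e u v g -> shortest (is_path e) g.
Proof.
move=> [gP gu gv gn _]; split=> // h hP; rewrite gu gv gn => <- <-.
exact: dist_le_plen.
Qed.

(** * The fellow traveler property and the bicombings *)

Variable R : realType.

Lemma fellow_traveler7 (T : Type) (dT : T -> T -> nat) (P : set (gpath T)) :
  (forall g h, P g -> P h -> forall i, (dT (pat g i) (pat h i) <=
     7 * maxn (dT (pstart g) (pstart h)) (dT (pend g) (pend h)) + 1)%N) ->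
  fellow_traveler R dT P.
Proof.
(* The additive constant 1 covers members with the same endpoints. *)
move=> H; exists (7%:R)%R, (1%:R)%R; split; rewrite ?ltr0n ?ler0n //.
move=> g h Pg Ph i.
by rewrite -natrM -natrD ler_nat; exact: H.
Qed.

Lemma fellow_traveler_normal_clique_paths :
  fellow_traveler R (cdist e) (normal_clique_paths e).
Proof.
apply: fellow_traveler7 => _ _ [u [v ->]] [u' [v' ->]] i.
rewrite !pstart_normal_clique_path !pend_normal_clique_path !cdist_set1.
apply: cdist_le => x y; rewrite !pat_normal_clique_path.
exact: nclique_fellow1.
Qed.

Lemma fellow_traveler_normal_paths :
  fellow_traveler R (dist e) (normal_paths e).
Proof.
apply: fellow_traveler7 => g h [u [v gP]] [u' [v' hP]] i.
have [_ -> -> _ _] := gP; have [_ -> -> _ _] := hP.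
exact: nclique_fellow1 (normal_path_nclique i gP) (normal_path_nclique i hP).
Qed.

End Distance.

Theorem theorem6p5 (R : realType) (V : choiceType) (e : rel V)
    (e_sym : symmetric e) (e_irr : irreflexive e)
    (e_conn : connected_graph e) (e_fin : finite_cliques e)
    (e_cb : convex_balls e) :
  [/\ forall u u' v v' : V, (u, v) <> (u', v') ->
        forall (i : nat) (x y : V),
          pat (normal_clique_path e u v) i x ->
          pat (normal_clique_path e u' v') i y ->
          (dist e x y <= 7 * maxn (dist e u u') (dist e v v'))%N,
      fellow_traveler R (cdist e) (normal_clique_paths e),
      fellow_traveler R (dist e) (normal_paths e),
      clique_path_bicombing e R (normal_clique_paths e) &
      path_bicombing e R (normal_paths e)].
Proof.
have ftC := fellow_traveler_normal_clique_paths e_sym e_irr e_conn e_cb e_fin R.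
have ftP := fellow_traveler_normal_paths e_sym e_irr e_conn e_cb e_fin R.
split=> //.
- move=> u u' v v' neq i x y.
  by rewrite !pat_normal_clique_path; exact: nclique_fellow.
- split=> // [_ [u [v ->]]|u v]; first exact: normal_clique_path_shortest.
  exists (normal_clique_path e u v); split; first by exists u, v.
    exact: pstart_normal_clique_path.
  exact: pend_normal_clique_path.
split=> // [g [u [v]]|u v]; first exact: normal_path_shortest.
have [g gP] := normal_path_exists e_sym e_irr e_conn e_cb e_fin u v.
by exists g; have [_ gu gv _ _] := gP; split=> //; exists u, v.
Qed.
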